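(* Let $\mathcal G$ be an undirected, connected, unweighted star network on $N_{\rm a}$ nodes, with central node $1$ and outer nodes $2,\dots,N_{\rm a}$, and adjacency matrix $A_{\rm a}$. Let $\mathcal G'$ be the effective communication network induced by heterogeneous projection constraints, i.e. the weighted graph with adjacency matrix $A_{\rm a}'$, $[A_{\rm a}']_{ik}=(\hat{\mathbf p}_i^T\hat{\mathbf p}_k)[A_{\rm a}]_{ik}$. Assume that $\hat{\mathbf p}_1^T\hat{\mathbf p}_j\neq 0$ for all $j\in\{2,\dots,N_{\rm a}\}$. Then the relative influence in $\mathcal G'$ of the outer nodes $j\in\{2,\dots,N_{\rm a}\}$ is proportional to $\hat{\mathbf p}_1^T\hat{\mathbf p}_j$ (with a proportionality constant common to all outer nodes). Furthermore, the most influential agent in $\mathcal G$ and $\mathcal G'$ remains unchanged.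
   Context: Each agent $i\in\{1,\dots,N_{\rm a}\}$ has a nonzero constraint vector $\mathbf p_i\in\mathbb{R}^{N_{\rm o}}$, with unit vector $\hat{\mathbf p}_i=\mathbf p_i/\|\mathbf p_i\|$ and rank-one projection constraint $P_i=\hat{\mathbf p}_i\hat{\mathbf p}_i^T$. The projection constraints are heterogeneous if they are not the same for all agents. In the star network, $[A_{\rm a}]_{1j}=[A_{\rm a}]_{j1}=1$ for $j\ge 2$ and all other entries are $0$. The relative influence of node $i$ in a network is the $i$-th component of the dominant eigenvector (eigenvector of the largest eigenvalue; eigenvector centrality) of its adjacency matrix, defined up to scaling; the most influential agent is the one with the largest component. For the unweighted star $\mathcal G$ this eigenvector is $(\sqrt{N_{\rm a}-1},1,\dots,1)^T$. *)

(* Defs.v *)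
From mathcomp Require Import all_boot all_order all_algebra.
From mathcomp Require Import reals.
Set Implicit Arguments.
Unset Strict Implicit.
Unset Printing Implicit Defensive.
Import Order.TTheory GRing.Theory Num.Theory.
Local Open Scope ring_scope.

Definition dot (R : realType) (o : nat) (u v : 'cV[R]_o) : R :=
  (u^T *m v) 0 0.

(* Euclidean norm; the norm MathComp-Analysis puts on matrices is the sup
   norm. *)
Definition enorm (R : realType) (o : nat) (u : 'cV[R]_o) : R :=
  Num.sqrt (dot u u).

Definition unitv (R : realType) (o : nat) (u : 'cV[R]_o) : 'cV[R]_o :=
  (enorm u)^-1 *: u.

Definition projection (R : realType) (o : nat) (u : 'cV[R]_o) : 'M[R]_o :=
  unitv u *m (unitv u)^T.

Definition heterogeneous (R : realType) (o n : nat) (p : 'I_n -> 'cV[R]_o) :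
    Prop :=
  exists i k : 'I_n, projection (p i) <> projection (p k).

(* Nodes are 0, ..., n, with centre ord0: exactly one end of an edge is the
   centre. *)
Definition star_adj (R : realType) (n : nat) : 'M[R]_n.+1 :=
  \matrix_(i, j) ((i == ord0) (+) (j == ord0))%:R.

Definition effective_adj (R : realType) (o n : nat) (p : 'I_n -> 'cV[R]_o)
    (A : 'M[R]_n) : 'M[R]_n :=
  \matrix_(i, k) (dot (unitv (p i)) (unitv (p k)) * A i k).

Definition largest_eigenvalue (R : realType) (n : nat) (A : 'M[R]_n) (a : R) :
    Prop :=
  eigenvalue A a /\ (forall b : R, eigenvalue A b -> b <= a).

(* eigenspace is about row vectors, v *m A = a *: v; the adjacency matrices
   above are symmetric, so left and right eigenvectors coincide. *)
Definition dominant_eigenvector (R : realType) (n : nat) (A : 'M[R]_n)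
    (v : 'rV[R]_n) : Prop :=
  v != 0 /\
  (exists a : R, largest_eigenvalue A a /\ (v <= eigenspace A a)%MS).

(* Influence is defined up to a nonzero, possibly negative, scalar, and
   effective weights may be negative, so components are compared in
   magnitude, which does not depend on the scaling. Ties are allowed: the two
   nodes of a star on two nodes are both most influential. *)
Definition most_influential (R : realType) (n : nat) (A : 'M[R]_n)
    (i : 'I_n) : Prop :=
  exists2 v : 'rV[R]_n, dominant_eigenvector A v &
    forall j : 'I_n, `|v 0 j| <= `|v 0 i|.

Definition strictly_largest (R : realType) (n : nat) (v : 'rV[R]_n)
    (i : 'I_n) : Prop :=
  forall j : 'I_n, j != i -> v 0 j < v 0 i.

(* Main.v *)
Require Import Defs.
From mathcomp Require Import all_boot all_order all_algebra.
From mathcomp Require Import reals.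
Set Implicit Arguments.
Unset Strict Implicit.
Unset Printing Implicit Defensive.
Import Order.TTheory GRing.Theory Num.Theory.
Local Open Scope ring_scope.

(** Both networks are weighted stars: the edge from the centre to the outer
node j has weight c j, with c constantly 1 for the unweighted star and c j the
scalar product of the unit vectors of the centre and of j for the effective
network.  The eigenvector equations of a weighted star read
[a v_j = c_j v_0] at the outer nodes and [a v_0 = \sum_j c_j v_j] at the
centre, so a nonzero eigenvalue satisfies [a ^ 2 = \sum_j c_j ^ 2].  Hence the
largest eigenvalue is r, the Euclidean norm of the weights, and a dominant
eigenvector is determined by its component at the centre, which is nonzero,
through [v_j = (v_0 / r) c_j] ([dominant_starP]); this is the proportionality
claim.

As [|c_j| <= r], the centre always has a component of largest magnitude, and
[|c_j| = r] exactly when all the other outer weights vanish.  When no weight is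
zero, a tie therefore occurs exactly when j is the only outer node
([most_influential_starP]).  This criterion does not mention the weights, so it
gives the same most influential nodes in both networks. *)

(** * Weighted stars *)

Definition weighted_star (R : realType) (n : nat) (c : 'I_n.+1 -> R) :
    'M[R]_n.+1 :=
  \matrix_(i, j) (if i == ord0 then (j != ord0)%:R * c j
                  else (j == ord0)%:R * c i).

(** The spectral radius of the star, which is the Euclidean norm of the outer
weights; the value of c at the centre is a dummy. *)
Definition star_radius (R : realType) (n : nat) (c : 'I_n.+1 -> R) : R :=
  Num.sqrt (\sum_(j | j != ord0) c j ^+ 2).

Lemma star_adj_weighted (R : realType) (n : nat) :
  star_adj R n = weighted_star (fun=> 1).
Proof.
by apply/matrixP=> i j; rewrite !mxE; case: eqP; case: eqP; rewrite mulr1.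
Qed.

Lemma dotC (R : realType) (o : nat) (u v : 'cV[R]_o) : dot u v = dot v u.
Proof. by rewrite /dot !mxE; apply: eq_bigr => k _; rewrite !mxE mulrC. Qed.

Lemma effective_adj_weighted (R : realType) (o n : nat)
    (p : 'I_n.+1 -> 'cV[R]_o) :
  effective_adj p (star_adj R n) =
  weighted_star (fun j => dot (unitv (p ord0)) (unitv (p j))).
Proof.
apply/matrixP=> i j; rewrite !mxE.
have [->|_] := eqVneq i ord0; first by rewrite mulrC.
by rewrite mulrC; have [->|_] := eqVneq j ord0; rewrite ?mul0r // dotC.
Qed.

(** * The eigenvector equations *)

Lemma mulmx_star_center (R : realType) (n : nat) (c : 'I_n.+1 -> R)
    (v : 'rV[R]_n.+1) :
  (v *m weighted_star c) 0 ord0 = \sum_(j | j != ord0) v 0 j * c j.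
Proof.
rewrite mxE (bigD1 ord0) //= !mxE eqxx mul0r mulr0 add0r.
by apply: eq_bigr => i /negPf i0; rewrite mxE i0 mul1r.
Qed.

Lemma mulmx_star_outer (R : realType) (n : nat) (c : 'I_n.+1 -> R)
    (v : 'rV[R]_n.+1) (j : 'I_n.+1) :
  j != ord0 -> (v *m weighted_star c) 0 j = v 0 ord0 * c j.
Proof.
move=> j0; rewrite mxE (bigD1 ord0) //= !mxE j0 mul1r big1 ?addr0 //.
by move=> i /negPf i0; rewrite mxE i0 (negPf j0) mul0r mulr0.
Qed.

Lemma star_eigenP (R : realType) (n : nat) (c : 'I_n.+1 -> R) (a : R)
    (v : 'rV[R]_n.+1) :
  v *m weighted_star c = a *: v <->
  (\sum_(j | j != ord0) v 0 j * c j = a * v 0 ord0) /\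
  (forall j, j != ord0 -> v 0 ord0 * c j = a * v 0 j).
Proof.
split=> [e|[e0 ej]].
  split=> [|j j0]; first by rewrite -mulmx_star_center e mxE.
  by rewrite -mulmx_star_outer // e mxE.
apply/rowP=> j; have [->|j0] := eqVneq j ord0.
  by rewrite mulmx_star_center mxE.
by rewrite mulmx_star_outer // mxE ej.
Qed.

(** * The norm of the weights *)

Lemma sqr_star_radius (R : realType) (n : nat) (c : 'I_n.+1 -> R) :
  star_radius c ^+ 2 = \sum_(j | j != ord0) c j ^+ 2.
Proof. by rewrite sqr_sqrtr // sumr_ge0 // => j _; rewrite sqr_ge0. Qed.

Lemma ler_norm_star_radius (R : realType) (n : nat) (c : 'I_n.+1 -> R)
    (j : 'I_n.+1) :
  j != ord0 -> `|c j| <= star_radius c.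
Proof.
move=> j0; rewrite -sqrtr_sqr ler_wsqrtr // (bigD1 j) //= lerDl.
by rewrite sumr_ge0 // => k _; rewrite sqr_ge0.
Qed.

Lemma ltr_norm_star_radius (R : realType) (n : nat) (c : 'I_n.+1 -> R)
    (j k : 'I_n.+1) :
  j != ord0 -> k != ord0 -> k != j -> c k != 0 -> `|c j| < star_radius c.
Proof.
move=> j0 k0 kj ck; have ck2 : 0 < c k ^+ 2 by rewrite exprn_even_gt0.
have s_gt0 : 0 < \sum_(i | (i != ord0) && (i != j)) c i ^+ 2.
  rewrite (bigD1 k) /= ?k0 // ltr_pwDl // sumr_ge0 // => i _.
  by rewrite sqr_ge0.
rewrite -sqrtr_sqr /star_radius (bigD1 j) //= ltr_sqrt ?ltrDl //.
by rewrite ltr_pwDr // sqr_ge0.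
Qed.

Lemma star_radius_single (R : realType) (n : nat) (c : 'I_n.+1 -> R)
    (j : 'I_n.+1) :
  j != ord0 -> (forall k, k != ord0 -> k = j) -> star_radius c = `|c j|.
Proof.
move=> j0 only_j; rewrite /star_radius (bigD1 j) //= big1 ?addr0 ?sqrtr_sqr //.
by move=> k /andP[/only_j -> ]; rewrite eqxx.
Qed.

Lemma star_radius_gt0 (R : realType) (n : nat) (c : 'I_n.+1 -> R)
    (j : 'I_n.+1) :
  j != ord0 -> c j != 0 -> 0 < star_radius c.
Proof.
by move=> j0 cj; apply: lt_le_trans (ler_norm_star_radius c j0); rewrite normr_gt0.
Qed.

(** * Dominant eigenvectors *)

(** Multiplying the equation at the centre by a and substituting the outer
ones gives [a ^ 2 v_0 = r ^ 2 v_0]. *)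
Lemma star_eigen_sqr (R : realType) (n : nat) (c : 'I_n.+1 -> R) (a : R)
    (v : 'rV[R]_n.+1) :
  v *m weighted_star c = a *: v -> v 0 ord0 != 0 -> a ^+ 2 = star_radius c ^+ 2.
Proof.
move=> /star_eigenP[e0 ej] v0; apply: (mulIf v0).
rewrite sqr_star_radius expr2 -mulrA -e0 mulr_sumr mulr_suml.
by apply: eq_bigr => j j0; rewrite mulrA -ej // expr2 mulrAC -mulrA mulrC.
Qed.

(** An eigenvector that vanishes at the centre vanishes at the outer nodes too
unless the eigenvalue is zero. *)
Lemma star_eigen_center_neq0 (R : realType) (n : nat) (c : 'I_n.+1 -> R) (a : R)
    (v : 'rV[R]_n.+1) :
  v *m weighted_star c = a *: v -> v != 0 -> a != 0 -> v 0 ord0 != 0.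
Proof.
move=> /star_eigenP[_ ej] vn0 a0; apply: contra vn0 => /eqP v0.
apply/eqP/rowP=> j; rewrite [RHS]mxE; have [->//|j0] := eqVneq j ord0.
by apply: (mulfI a0); rewrite -ej // v0 mul0r mulr0.
Qed.

Lemma star_eigen_radius (R : realType) (n : nat) (c : 'I_n.+1 -> R)
    (v : 'rV[R]_n.+1) :
  0 < star_radius c ->
  (forall j, j != ord0 -> star_radius c * v 0 j = v 0 ord0 * c j) ->
  v *m weighted_star c = star_radius c *: v.
Proof.
move=> r_gt0 ej; apply/star_eigenP; split=> [|j j0]; last by rewrite ej.
apply: (mulfI (lt0r_neq0 r_gt0)).
rewrite [RHS]mulrA -expr2 sqr_star_radius mulr_sumr mulr_suml.
by apply: eq_bigr => j j0; rewrite mulrA ej // expr2 -mulrA mulrC.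
Qed.

Definition star_vector (R : realType) (n : nat) (c : 'I_n.+1 -> R) :
    'rV[R]_n.+1 :=
  \row_j (if j == ord0 then star_radius c else c j).

(** An eigenvalue above r would be positive, so its eigenvectors would not
vanish at the centre and its square would be [r ^ 2]. *)
Lemma star_largest_eigenvalue (R : realType) (n : nat) (c : 'I_n.+1 -> R) :
  0 < star_radius c ->
  largest_eigenvalue (weighted_star c) (star_radius c).
Proof.
move=> r_gt0; split=> [|b /eigenvalueP[v ev vn0]].
  apply/eigenvalueP; exists (star_vector c); last first.
    apply/eqP=> /rowP/(_ ord0); rewrite !mxE eqxx => r0.
    by rewrite r0 ltxx in r_gt0.
  by apply: star_eigen_radius => // j /negPf j0; rewrite !mxE j0 eqxx.
rewrite leNgt; apply/negP=> lt_rb.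
have b_gt0 := lt_trans r_gt0 lt_rb.
have v0 := star_eigen_center_neq0 ev vn0 (lt0r_neq0 b_gt0).
have := star_eigen_sqr ev v0; move/eqP.
by rewrite eqrXn2 ?ltW // gt_eqF.
Qed.

Lemma dominant_starP (R : realType) (n : nat) (c : 'I_n.+1 -> R)
    (v : 'rV[R]_n.+1) :
  0 < star_radius c ->
  dominant_eigenvector (weighted_star c) v <->
  v 0 ord0 != 0 /\
  (forall j, j != ord0 -> v 0 j = v 0 ord0 / star_radius c * c j).
Proof.
move=> r_gt0; have rn0 := lt0r_neq0 r_gt0.
have [r_eig r_max] := star_largest_eigenvalue r_gt0.
split=> [[vn0 [a [[a_eig a_max] /eigenspaceP ev]]]|[v0 ej]].
  have a_r : a = star_radius c by apply/le_anti; rewrite r_max // a_max.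
  rewrite a_r in ev; split; first exact: star_eigen_center_neq0 ev vn0 rn0.
  case/star_eigenP: ev => _ ej j j0.
  by apply: (mulfI rn0); rewrite -ej // mulrA (mulrC (star_radius c)) divfK.
split; first by apply: contra v0 => /eqP->; rewrite mxE.
exists (star_radius c); split=> //; apply/eigenspaceP.
by apply: star_eigen_radius => // j j0; rewrite ej // mulrA (mulrC (star_radius c)) divfK.
Qed.

Lemma star_vector_dominant (R : realType) (n : nat) (c : 'I_n.+1 -> R) :
  0 < star_radius c -> dominant_eigenvector (weighted_star c) (star_vector c).
Proof.
move=> r_gt0; have rn0 := lt0r_neq0 r_gt0.
apply/dominant_starP => //; rewrite !mxE eqxx; split=> // j /negPf j0.
by rewrite mxE j0 divff ?mul1r.
Qed.

(** * The most influential nodes *)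

Lemma dominant_star_norm (R : realType) (n : nat) (c : 'I_n.+1 -> R)
    (v : 'rV[R]_n.+1) (j : 'I_n.+1) :
  0 < star_radius c -> dominant_eigenvector (weighted_star c) v ->
  j != ord0 -> `|v 0 j| = `|v 0 ord0| / star_radius c * `|c j|.
Proof.
move=> r_gt0 /dominant_starP-/(_ r_gt0)[_ ej] j0.
by rewrite ej // !normrM normfV (gtr0_norm r_gt0).
Qed.

Lemma dominant_star_center_max (R : realType) (n : nat) (c : 'I_n.+1 -> R)
    (v : 'rV[R]_n.+1) (j : 'I_n.+1) :
  0 < star_radius c -> dominant_eigenvector (weighted_star c) v ->
  `|v 0 j| <= `|v 0 ord0|.
Proof.
move=> r_gt0 dom_v; have [->//|j0] := eqVneq j ord0.
rewrite (dominant_star_norm r_gt0 dom_v j0) -mulrA ler_piMr //.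
by rewrite mulrC ler_pdivrMr // mul1r ler_norm_star_radius.
Qed.

Lemma dominant_star_center_gt (R : realType) (n : nat) (c : 'I_n.+1 -> R)
    (v : 'rV[R]_n.+1) (j k : 'I_n.+1) :
  dominant_eigenvector (weighted_star c) v ->
  j != ord0 -> k != ord0 -> k != j -> c k != 0 ->
  `|v 0 j| < `|v 0 ord0|.
Proof.
move=> dom_v j0 k0 kj ck; have r_gt0 := star_radius_gt0 k0 ck.
have /dominant_starP-/(_ r_gt0)[v0 _] := dom_v.
rewrite (dominant_star_norm r_gt0 dom_v j0) -mulrA gtr_pMr ?normr_gt0 //.
by rewrite mulrC ltr_pdivrMr // mul1r (ltr_norm_star_radius j0 k0).
Qed.

(** With one outer node, [r = |c_j|], and the two nodes tie. *)
Lemma dominant_star_single (R : realType) (n : nat) (c : 'I_n.+1 -> R)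
    (v : 'rV[R]_n.+1) (j : 'I_n.+1) :
  dominant_eigenvector (weighted_star c) v ->
  j != ord0 -> c j != 0 -> (forall k, k != ord0 -> k = j) ->
  `|v 0 j| = `|v 0 ord0|.
Proof.
move=> dom_v j0 cj only_j.
rewrite (dominant_star_norm (star_radius_gt0 j0 cj) dom_v j0).
by rewrite (star_radius_single _ j0) // divfK ?normr_eq0.
Qed.

(** The criterion on the right does not depend on the weights, which is why
reweighting the edges of a star by nonzero numbers preserves the most
influential nodes. *)
Lemma most_influential_starP (R : realType) (n : nat) (c : 'I_n.+1 -> R)
    (i : 'I_n.+1) :
  (exists j : 'I_n.+1, j != ord0) -> (forall j, j != ord0 -> c j != 0) ->
  most_influential (weighted_star c) i <->
  i = ord0 \/ (forall k, k != ord0 -> k = i).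
Proof.
move=> [j0 j0n] c_neq0; have r_gt0 := star_radius_gt0 j0n (c_neq0 _ j0n).
split=> [[v dom_v v_max]|i_spec].
  have [->|in0] := eqVneq i ord0; [by left | right=> k kn0].
  apply/eqP/negPn/negP=> ki.
  have := dominant_star_center_gt dom_v in0 kn0 ki (c_neq0 _ kn0).
  by rewrite ltNge v_max.
have dom_s := star_vector_dominant r_gt0.
exists (star_vector c) => // j.
apply: le_trans (dominant_star_center_max j r_gt0 dom_s) _.
case: i_spec => [-> //|only_i].
have [->//|in0] := eqVneq i ord0.
by rewrite (dominant_star_single dom_s in0 (c_neq0 _ in0) only_i).
Qed.

(** With positive component at the centre, the centre also bounds the signed
components, so no outer node can beat it. *)
Lemma strictly_largest_center (R : realType) (n : nat) (c : 'I_n.+1 -> R)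
    (v : 'rV[R]_n.+1) (i : 'I_n.+1) :
  0 < star_radius c -> dominant_eigenvector (weighted_star c) v ->
  0 < v 0 ord0 -> strictly_largest v i -> i = ord0.
Proof.
move=> r_gt0 dom_v v_gt0 v_max; apply/eqP/negPn/negP=> i0.
have := v_max ord0; rewrite eq_sym => /(_ i0); rewrite ltNge.
rewrite (le_trans (ler_norm _)) //.
rewrite -(gtr0_norm v_gt0).
exact: dominant_star_center_max r_gt0 dom_v.
Qed.

(** A single node carries a single constraint, so heterogeneity excludes the
degenerate star without edges, whose only eigenvalue is zero. *)
Lemma heterogeneous_outer (R : realType) (o n : nat)
    (p : 'I_n.+1 -> 'cV[R]_o) :
  heterogeneous p -> exists j : 'I_n.+1, j != ord0.
Proof.
move=> [i [k]]; have [->|i0 _] := eqVneq i ord0; last by exists i.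
by have [->|k0 _] := eqVneq k ord0; last by exists k.
Qed.

(** * The effective network *)

Theorem mainTheorem6 (R : realType) (o n : nat) (p : 'I_n.+1 -> 'cV[R]_o)
    (p_neq0 : forall i : 'I_n.+1, p i != 0)
    (p_het : heterogeneous p)
    (p_dot : forall j : 'I_n.+1, j != ord0 ->
       dot (unitv (p ord0)) (unitv (p j)) != 0) :
  let A := star_adj R n in
  let A' := effective_adj p A in
  [/\ exists w : 'rV[R]_n.+1, dominant_eigenvector A' w,
      forall w : 'rV[R]_n.+1, dominant_eigenvector A' w ->
        exists k : R, k != 0 /\
          (forall j : 'I_n.+1, j != ord0 ->
             w 0 j = k * dot (unitv (p ord0)) (unitv (p j))),
      forall i : 'I_n.+1, most_influential A i <-> most_influential A' i
    & forall v w : 'rV[R]_n.+1,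
        dominant_eigenvector A v -> dominant_eigenvector A' w ->
        0 < v 0 ord0 -> 0 < w 0 ord0 ->
        forall i : 'I_n.+1, strictly_largest v i -> strictly_largest w i].
Proof.
move=> A A'; rewrite /A' effective_adj_weighted /A star_adj_weighted.
set c := fun j => dot _ _; set u := fun=> 1.
have [j1 j1n] := heterogeneous_outer p_het.
have u_neq0 (j : 'I_n.+1) : j != ord0 -> u j != 0 by rewrite oner_neq0.
have rc_gt0 : 0 < star_radius c := star_radius_gt0 j1n (p_dot _ j1n).
have ru_gt0 : 0 < star_radius u := star_radius_gt0 j1n (u_neq0 _ j1n).
split.
- by exists (star_vector c); apply: star_vector_dominant.
- move=> w /dominant_starP-/(_ rc_gt0)[w0 wj].
  exists (w 0 ord0 / star_radius c); split=> //.
  by rewrite mulf_neq0 // invr_eq0 gt_eqF.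
- move=> i; have outer : exists j : 'I_n.+1, j != ord0 by exists j1.
  exact: iff_trans (most_influential_starP i outer u_neq0)
                   (iff_sym (most_influential_starP i outer p_dot)).
- move=> v w dom_v dom_w v_gt0 w_gt0 i v_max.
  have i0 := strictly_largest_center ru_gt0 dom_v v_gt0 v_max; subst i.
  move=> j j0; have [/existsP[k /andP[k0 kj]]|no_k] :=
    boolP [exists k, (k != ord0) && (k != j)].
    apply: le_lt_trans (ler_norm _) _; rewrite -(gtr0_norm w_gt0).
    exact: dominant_star_center_gt dom_w j0 k0 kj (p_dot _ k0).
  (* If j is the only outer node, the unweighted star has a tie between j and
     the centre, against the strict maximality of the centre in v. *)
  have only_j k : k != ord0 -> k = j.
    by move=> k0; move/existsPn: no_k => /(_ k); rewrite k0 negbK => /eqP.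
  have := v_max j j0.
  have /dominant_starP-/(_ ru_gt0)[_ ->] // := dom_v.
  by rewrite (star_radius_single u j0 only_j) normr1 divr1 mulr1 ltxx.
Qed.
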